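(* Let $P\subset\mathbb{C}$ be an open half-plane such that $0\in P$, and write points as $x+iy$ with $x,y\in\mathbb{R}$. (1) If $P$ is described either by $y<ax+b$ with $a,b\in\mathbb{R}$, $b>0$, or by $y>ax+b$ with $a,b\in\mathbb{R}$, $b<0$, then $$\iota(P) = \left(\overline{\mathbb{C}}\setminus\{0\}\right)\setminus \overline{B}\left(\frac{-a}{2b} + i\,\frac{-1}{2b},\ \frac{\sqrt{a^2+1}}{2|b|}\right).$$ (2) If $P$ is described either by $x<c$ with $c>0$, or by $x>c$ with $c<0$, then $$\iota(P) = \left(\overline{\mathbb{C}}\setminus\{0\}\right)\setminus \overline{B}\left(\frac{1}{2c},\ \frac{1}{2|c|}\right).$$
   Context: $\overline{\mathbb{C}}=\mathbb{C}\cup\{\infty\}$ is the Riemann sphere and $\iota:\overline{\mathbb{C}}\to\overline{\mathbb{C}}$ is the inversion $\iota(z)=z^{-1}$ with $\iota(0)=\infty$ and $\iota(\infty)=0$. $\overline{B}(w,r)=\{z\in\mathbb{C}:|z-w|\le r\}$ is the closed ball in $\mathbb{C}$. *)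

(* Defs.v *)
From mathcomp Require Import all_boot all_order all_algebra.
From mathcomp Require Import boolp classical_sets reals.
From mathcomp Require Import one_point_compactification.
From mathcomp Require Import pseudometric_normed_Zmodule.
From mathcomp Require Export complex.

Set Implicit Arguments.
Unset Strict Implicit.
Unset Printing Implicit Defensive.

Local Open Scope classical_set_scope.
Local Open Scope ring_scope.
Local Open Scope complex_scope.

(* [None] is the point at infinity and [Some z] the finite point z. *)
Definition riemann_sphere (R : realType) : Type :=
  one_point_compactification R[i].

Definition to_sphere (R : realType) (z : R[i]) : riemann_sphere R := Some z.

Definition infinity (R : realType) : riemann_sphere R := None.

Definition inversion (R : realType) (p : riemann_sphere R) :
    riemann_sphere R :=
  if p is Some z then
    if z == 0 then infinity R else to_sphere z^-1
  else to_sphere 0.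

Definition open_half_plane (R : realType) (P : set R[i]) : Prop :=
  exists s t u : R, (s != 0 \/ t != 0) /\
    P = [set z | s * Re z + t * Im z < u].

(* The norm of [R[i]] takes its values in [R[i]], hence the cast of r. *)
Definition cball (R : realType) (w : R[i]) (r : R) : set R[i] :=
  closed_ball_ (fun z : R[i] => `|z|) w r%:C.

(* Main.v *)
Require Import Defs.
From mathcomp Require Import all_boot all_order all_algebra.
From mathcomp Require Import boolp classical_sets reals.
From mathcomp Require Import pseudometric_normed_Zmodule.
From mathcomp Require Import ring lra.

Import Order.TTheory GRing.Theory Num.Theory.
(* [Num.Theory] also has [Re] and [Im]: import [complex] last. *)
From mathcomp Require Import complex.

Local Open Scope classical_set_scope.
Local Open Scope ring_scope.
Local Open Scope complex_scope.

(** Each of the four half-planes has the form [s * Re z + t * Im z < u] with [u > 0], so one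
    computation, [inversion_half_plane], covers them all. As inversion is an involution, a finite
    [w != 0] lies in the image iff [w^-1] lies in the half-plane ([inversion_image_setD]). Clearing
    the denominator |w|^2 makes this linear condition quadratic, and it says that [w] is outside a
    closed disc whose boundary circle passes through 0. *)

Lemma cball_ReIm (R : realType) (p q k x y : R) : 0 <= k ->
  cball (p +i* q) (Num.sqrt k) (x +i* y) <->
  (p - x) ^+ 2 + (q - y) ^+ 2 <= k.
Proof.
move=> k0; rewrite /cball /closed_ball_ /= normc_def /= lecR.
by rewrite ler_sqrt.
Qed.

(** The only preimage of a finite [w != 0] is [w^-1]. Infinity is reached from 0, which is in [P],
    whereas 0 could come only from infinity, which is not in the image of [P]. *)
Lemma inversion_image_setD (R : realType) (P B : set R[i]) : P 0 ->
  (forall w, w != 0 -> P w^-1 <-> ~ B w) ->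
  @inversion R @` (@to_sphere R @` P) =
  ([set: riemann_sphere R] `\` [set to_sphere 0]) `\` (@to_sphere R @` B).
Proof.
move=> P0 PB; apply/seteqP; split=> [_ [_ [z Pz <-] <-]|[w|] /=].
- rewrite /inversion /=; case: eqVneq => [_|z0]; first by split; [split|case].
  split; first by split=> // -[] /eqP; rewrite invr_eq0 (negbTE z0).
  case=> w + [] wE; rewrite wE; apply/PB; first by rewrite invr_eq0.
  by rewrite invrK.
- move=> [[_ w_neq0] nB].
  have w0 : w != 0 by apply: contra_notN w_neq0 => /eqP ->.
  exists (to_sphere w^-1); last first.
    by rewrite /inversion /= invr_eq0 (negbTE w0) invrK.
  by exists w^-1 => //; apply/PB => // Bw; apply: nB; exists w.
- by move=> _; exists (to_sphere 0); [exists 0|rewrite /inversion /= eqxx].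
Qed.

(* For [w = x + iy], multiplying [s Re (1/w) + t Im (1/w) >= u] by [|w|^2 / u]
   gives [|w|^2 - (s/u) x + (t/u) y <= 0]; complete the squares. *)
Lemma inversion_half_plane (R : realType) (s t u : R) : 0 < u ->
  @inversion R @` (@to_sphere R @` [set z | s * Re z + t * Im z < u]) =
  ([set: riemann_sphere R] `\` [set to_sphere 0]) `\`
    (@to_sphere R @` cball ((s / (2 * u)) +i* (- t / (2 * u)))
                           (Num.sqrt (s ^+ 2 + t ^+ 2) / (2 * u))).
Proof.
move=> u0; have u20 : 0 < 2 * u by rewrite mulr_gt0.
have k0 : 0 <= (s ^+ 2 + t ^+ 2) / (2 * u) ^+ 2.
  by rewrite divr_ge0 ?addr_ge0 ?sqr_ge0.
(* The radius becomes a single square root, the form [cball_ReIm] expects; [u > 0] gives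
   [|2 * u| = 2 * u]. *)
have -> : Num.sqrt (s ^+ 2 + t ^+ 2) / (2 * u) =
    Num.sqrt ((s ^+ 2 + t ^+ 2) / (2 * u) ^+ 2).
  rewrite sqrtrM ?addr_ge0 ?sqr_ge0// sqrtrV ?sqr_ge0// sqrtr_sqr.
  by rewrite gtr0_norm.
apply: inversion_image_setD => [|[x y] w0]; first by rewrite /= !mulr0 addr0.
have N0 : 0 < x ^+ 2 + y ^+ 2.
  rewrite lt_neqAle addr_ge0 ?sqr_ge0// andbT eq_sym.
  by rewrite paddr_eq0 ?sqr_ge0// !sqrf_eq0 -[_ && _](eq_complex (x +i* y) 0).
rewrite cball_ReIm // (rwP negP) -ltNge /=.
rewrite -propeqE; congr is_true.
(* Scaled by |w|^2 on the left and by [u] on the right, both differences equal u (x^2 + y^2) - s x +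
   t y. *)
rewrite -subr_gt0 -[RHS]subr_gt0 -(pmulr_rgt0 _ N0) -[RHS](pmulr_rgt0 _ u0).
by congr (0 < _); field; rewrite !gt_eqF.
Qed.

Theorem theorem10 (R : realType) (P : set R[i])
    (hP : open_half_plane P) (h0 : P 0) :
  (forall a b : R,
     (0 < b /\ P = [set z | Im z < a * Re z + b]) \/
     (b < 0 /\ P = [set z | Im z > a * Re z + b]) ->
     @inversion R @` (@to_sphere R @` P) =
     ([set: riemann_sphere R] `\` [set to_sphere 0]) `\`
       (@to_sphere R @`
          cball ((- a / (2 * b)) +i* (-1 / (2 * b)))
                (Num.sqrt (a ^+ 2 + 1) / (2 * `|b|)))) /\
  (forall c : R,
     (0 < c /\ P = [set z | Re z < c]) \/
     (c < 0 /\ P = [set z | Re z > c]) ->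
     @inversion R @` (@to_sphere R @` P) =
     ([set: riemann_sphere R] `\` [set to_sphere 0]) `\`
       (@to_sphere R @` cball (1 / (2 * c))%:C (1 / (2 * `|c|)))).
Proof.
split=> [a b|c] [[n0 ->]|[n0 ->]].
- have -> : [set z : R[i] | Im z < a * Re z + b] =
            [set z | - a * Re z + 1 * Im z < b].
    by apply/funext => z; apply/propext; split=> /=; lra.
  by rewrite inversion_half_plane// gtr0_norm// sqrrN expr1n.
(* Negating the inequality makes the bound [- b], which is positive and equals [|b|], as the radius
   requires; in the centre the sign changes are absorbed by the quotients. *)
- have -> : [set z : R[i] | Im z > a * Re z + b] =
            [set z | a * Re z + -1 * Im z < - b].
    by apply/funext => z; apply/propext; split=> /=; lra.
  rewrite inversion_half_plane ?oppr_gt0// ltr0_norm// sqrrN expr1n.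
  by rewrite opprK mulrN !invrN !mulrN !mulNr.
- have -> : [set z : R[i] | Re z < c] = [set z | 1 * Re z + 0 * Im z < c].
    by apply/funext => z; apply/propext; split=> /=; lra.
  rewrite inversion_half_plane// gtr0_norm// expr1n expr0n addr0 sqrtr1.
  by rewrite oppr0 mul0r.
- have -> : [set z : R[i] | Re z > c] = [set z | -1 * Re z + 0 * Im z < - c].
    by apply/funext => z; apply/propext; split=> /=; lra.
  rewrite inversion_half_plane ?oppr_gt0// ltr0_norm// sqrrN expr1n expr0n.
  by rewrite addr0 sqrtr1 oppr0 mul0r mulrN invrN mulrNN.
Qed.
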